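(* Let $\boldsymbol\Sigma\in\mathbb{R}^{n\times n}$ be positive definite, and let $\mathbf{x}$ have the distribution given by the hierarchical Vecchia (HV) approximation $\hat p(\mathbf{x}) = \prod_{m=0}^M \prod_{j_1,\ldots,j_m} p(\mathcal{X}_{j_1,\ldots,j_m} \mid \mathcal{A}_{j_1,\ldots,j_m})$ of $\mathcal{N}_n(\boldsymbol\mu,\boldsymbol\Sigma)$, with conditioning sets $\mathcal{C}_i$. Denote $\mathrm{Var}(\mathbf{x})=\hat{\boldsymbol\Sigma}$ (the covariance matrix under $\hat p$) and $\mathbf{L}=\mathrm{chol}(\hat{\boldsymbol\Sigma})$. Let $\mathbf{S}\in\{0,1\}^{n\times n}$ be the lower-triangular matrix with $\mathbf{S}_{i,j}=1$ if $x_j\in\mathcal{C}_i$ or $i=j$, and $\mathbf{S}_{i,j}=0$ otherwise. Then $$\mathbf{L}=\mathrm{ichol}(\boldsymbol\Sigma,\mathbf{S}),$$ where $\mathrm{ichol}$ is the incomplete Cholesky decomposition applied to the exact covariance matrix $\boldsymbol\Sigma$ with sparsity pattern $\mathbf{S}$.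
   Context: For a symmetric positive-definite matrix $\mathbf{A}$, $\mathrm{chol}(\mathbf{A})$ is the unique lower-triangular matrix $\mathbf{B}$ with positive diagonal and $\mathbf{B}\mathbf{B}^\top=\mathbf{A}$. Incomplete Cholesky decomposition: for positive-definite $\mathbf{A}\in\mathbb{R}^{n\times n}$ and $\mathbf{S}\in\{0,1\}^{n\times n}$, $\mathrm{ichol}(\mathbf{A},\mathbf{S})$ is the lower-triangular matrix $\mathbf{L}$ computed as follows, with all entries not assigned equal to $0$. For $i=1,\ldots,n$: for $j=1,\ldots,i-1$, if $\mathbf{S}_{i,j}=1$ set $\mathbf{L}_{i,j}=\bigl(\mathbf{A}_{i,j}-\sum_{k=1}^{j-1}\mathbf{L}_{i,k}\mathbf{L}_{j,k}\bigr)/\mathbf{L}_{j,j}$; then set $\mathbf{L}_{i,i}=\bigl(\mathbf{A}_{i,i}-\sum_{k=1}^{i-1}\mathbf{L}_{i,k}^2\bigr)^{1/2}$. (Only the entries $\mathbf{A}_{i,j}$ with $\mathbf{S}_{i,j}=1$, including the diagonal, are used.) Hierarchical partition: let $\mathbf{x}=(x_1,\ldots,x_n)^\top$, $M\ge 0$ and $J_1,\ldots,J_M\ge 1$. The elements of $\mathbf{x}$ are partitioned into pairwise disjoint sets $\mathcal{X}_{j_1,\ldots,j_m}$, indexed by $m\in\{0,\ldots,M\}$ and $j_k\in\{1,\ldots,J_k\}$ for $k=1,\ldots,m$ (for $m=0$ there is a single set, written $\mathcal{X}$). Level $m$ is $\mathcal{X}^0=\mathcal{X}$ and $\mathcal{X}^m=\bigcup_{j_1=1}^{J_1}\cdots\bigcup_{j_m=1}^{J_m}\mathcal{X}_{j_1,\ldots,j_m}$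 for $m\ge1$; the union of all levels consists of all elements of $\mathbf{x}$. The ordering of $\mathbf{x}$ is compatible with the levels: if $i>j$, $x_i\in\mathcal{X}^{m_1}$ and $x_j\in\mathcal{X}^{m_2}$, then $m_1\ge m_2$. Ancestors and HV approximation: the ancestor set of $\mathcal{X}_{j_1,\ldots,j_m}$ is $\mathcal{A}_{j_1,\ldots,j_m}=\mathcal{X}\cup\mathcal{X}_{j_1}\cup\mathcal{X}_{j_1,j_2}\cup\cdots\cup\mathcal{X}_{j_1,\ldots,j_{m-1}}$ (empty for $m=0$). With $p$ denoting (conditional) densities under the exact distribution $\mathcal{N}_n(\boldsymbol{\mu},\boldsymbol{\Sigma})$, the HV approximation is the (multivariate normal) density $\hat p(\mathbf{x})=\prod_{m=0}^M\prod_{j_1,\ldots,j_m}p(\mathcal{X}_{j_1,\ldots,j_m}\mid\mathcal{A}_{j_1,\ldots,j_m})$; equivalently $\hat p(\mathbf{x})=\prod_{i=1}^n p(x_i\mid\mathcal{C}_i)$, where the conditioning set of $x_i\in\mathcal{X}_{j_1,\ldots,j_m}$ is $\mathcal{C}_i=\mathcal{A}_{j_1,\ldots,j_m}\cup\{x_k\in\mathcal{X}_{j_1,\ldots,j_m}:k<i\}$. *)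

(* Defs.v *)
From mathcomp Require Import all_boot all_order all_algebra.
From mathcomp Require Import all_classical all_reals all_analysis.

Set Implicit Arguments.
Unset Strict Implicit.
Unset Printing Implicit Defensive.

Import Order.TTheory GRing.Theory Num.Theory.
Import numFieldNormedType.Exports.

Local Open Scope ring_scope.

Section Matrices.
Context {R : realType} {n : nat}.
Implicit Types A B L : 'M[R]_n.

Definition posdefmx A : Prop :=
  A^T = A /\ forall v : 'cV[R]_n, v != 0 -> 0 < (v^T *m A *m v) 0 0.

(* [is_trig_mx] means lower triangular. *)
Definition is_chol A B : Prop :=
  [/\ is_trig_mx B, forall i, 0 < B i i & B *m B^T = A].

(* Only meaningful when [posdefmx A], where the factor exists and is unique;
   the default value of [xget] is irrelevant. *)
Definition chol A : 'M[R]_n := xget 0 [set B | is_chol A B]%classic.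

Definition set_entry L (i j : 'I_n) (v : R) : 'M[R]_n :=
  \matrix_(a, b) (if (a == i) && (b == j) then v else L a b).

Definition ichol_entry A (S : 'M[bool]_n) (i : 'I_n) L (j : 'I_n) : 'M[R]_n :=
  if S i j then
    set_entry L i j
      ((A i j - \sum_(k < n | (k < j)%N) L i k * L j k) / L j j)
  else L.

Definition ichol_row A (S : 'M[bool]_n) L (i : 'I_n) : 'M[R]_n :=
  let L' := foldl (ichol_entry A S i) L [seq j : 'I_n <- enum 'I_n | (j < i)%N] in
  set_entry L' i i
    (Num.sqrt (A i i - \sum_(k < n | (k < i)%N) L' i k ^+ 2)).

(* [enum 'I_n] is increasing: rows are filled top to bottom, each one from
   left to right, starting from the zero matrix. *)
Definition ichol A (S : 'M[bool]_n) : 'M[R]_n :=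
  foldl (ichol_row A S) 0 (enum 'I_n).

End Matrices.

Section Densities.
Context {R : realType} {n : nat}.

(* R^n is [n.-tuple R], which carries the product sigma-algebra. *)
Implicit Types (x : n.-tuple R) (p : n.-tuple R -> R).

Definition mvn_pdf (mu : 'cV[R]_n) (Sigma : 'M[R]_n) x : R :=
  let z : 'cV[R]_n := (\col_i tnth x i) - mu in
  (Num.sqrt ((2 * pi) ^+ n * \det Sigma))^-1
  * expR (- (z^T *m invmx Sigma *m z) 0 0 / 2).

Definition set_coord x (k : 'I_n) (t : R) : n.-tuple R :=
  [tuple if i == k then t else tnth x i | i < n].

(* Lebesgue integration over the coordinates listed in [s], the last one
   innermost; the result is still a function on R^n, which does not depend on
   the coordinates in [s]. *)
Definition integrate_out (s : seq 'I_n) (f : n.-tuple R -> \bar R) :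
    n.-tuple R -> \bar R :=
  foldr (fun k g x => \int[lebesgue_measure]_t g (set_coord x k t))%E f s.

(* The point at which the resulting constant function is evaluated is
   irrelevant. *)
Definition integral_Rn (f : n.-tuple R -> \bar R) : \bar R :=
  integrate_out (enum 'I_n) f [tuple 0 | _ < n].

(* Density of the subvector with indices in [B]. *)
Definition marginal_pdf p (B : {set 'I_n}) x : R :=
  fine (integrate_out (enum (~: B)) (fun y => (p y)%:E) x).

(* Conditional density of the subvector with indices in [A] given the one with
   indices in [B], for disjoint [A] and [B]. *)
Definition cond_pdf p (A B : {set 'I_n}) x : R :=
  marginal_pdf p (A :|: B) x / marginal_pdf p B x.

Definition has_pdf d (Omega : measurableType d) (P : probability Omega R)
    (X : 'I_n -> {RV P >-> R}) p : Prop :=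
  forall B : set (n.-tuple R), measurable B ->
    P [set w | B [tuple X i w | i < n]]%classic =
    integral_Rn (fun y => (\1_B y * p y)%:E).

Definition covmx d (Omega : measurableType d) (P : probability Omega R)
    (X : 'I_n -> {RV P >-> R}) : 'M[R]_n :=
  \matrix_(i, j) fine (covariance P (X i) (X j)).

End Densities.

(* The multi-indices (j_1, ..., j_m) with m <= M = size J and 1 <= j_k <= J_k,
   each one represented by the sequence [:: j_1; ...; j_m]. *)
Fixpoint nodes (J : seq nat) : seq (seq nat) :=
  if J is J1 :: J' then
    [::] :: [seq j :: s | j <- iota 1 J1, s <- nodes J']
  else [:: [::]].

Lemma mem_nodes (J s : seq nat) :
  (s \in nodes J) =
  (size s <= size J)%N && all2 (fun j Jk => 0 < j <= Jk)%N s (take (size s) J).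
Proof.
elim: J s => [|J1 J IH] [|j s] //=.
rewrite inE /= ltnS andbCA -IH.
apply/allpairsP/andP => [[[a b] /= [Ha Hb [-> ->]]]|[Hj Hs]].
  by rewrite Hb; split=> //; move: Ha; rewrite mem_iota add1n ltnS.
by exists (j, s); split=> //=; rewrite mem_iota add1n ltnS.
Qed.

Lemma nodes_uniq (J : seq nat) : uniq (nodes J).
Proof.
elim: J => [|J1 J IH] //=; apply/andP; split.
  by apply/negP => /allpairsP[[a b] /= []].
by apply: allpairs_uniq; rewrite ?iota_uniq// => -[a b] [a' b'] _ _ /= [-> ->].
Qed.

Section Hierarchy.
Context {n : nat}.

(* [X [:: j_1; ...; j_m]] is the set of the indices i with x_i in the set
   labelled by (j_1, ..., j_m); its values outside [nodes J] play no role. *)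
Implicit Types (J : seq nat) (X : seq nat -> {set 'I_n}).

Definition level J X (m : nat) : {set 'I_n} :=
  \bigcup_(s <- nodes J | size s == m) X s.

Definition hierarchical_partition J X : Prop :=
  [/\ {in J, forall Jk, (0 < Jk)%N},
      {in nodes J &, forall s t, s != t -> [disjoint X s & X t]},
      \bigcup_(s <- nodes J) X s = [set: 'I_n]%SET
    & forall (i j : 'I_n) (m1 m2 : nat), (j < i)%N ->
        i \in level J X m1 -> j \in level J X m2 -> (m2 <= m1)%N].

Definition ancestors X (s : seq nat) : {set 'I_n} :=
  \bigcup_(m < size s) X (take m s).

Definition conditioning_set J X (i : 'I_n) : {set 'I_n} :=
  \bigcup_(s <- nodes J | i \in X s)
    (ancestors X s :|: [set k in X s | (k < i)%N]%SET).

Definition sparsity J X : 'M[bool]_n :=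
  \matrix_(i, j) ((j \in conditioning_set J X i) || (i == j)).

Definition hv_pdf (R : realType) J X (mu : 'cV[R]_n) (Sigma : 'M[R]_n)
    (x : n.-tuple R) : R :=
  \prod_(s <- nodes J) cond_pdf (mvn_pdf mu Sigma) (X s) (ancestors X s) x.

End Hierarchy.

(* Main.v *)
Require Import Defs.
From mathcomp Require Import all_boot all_order all_algebra.
From mathcomp Require Import fingroup perm.
From mathcomp Require Import all_classical all_reals all_analysis.
From mathcomp Require Import measurable_realfun ring lra.

Set Implicit Arguments.
Unset Strict Implicit.
Unset Printing Implicit Defensive.

Import Order.TTheory GRing.Theory Num.Theory.

Local Open Scope ring_scope.

(** The conditioning sets are nested as in a tree: for [j] in [C i], [C j] is
    the part of [C i] below [j].  Let row [i] of the unitriangular matrix [W]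
    be the residual of [x_i] after the linear regression on [C i], and let [D]
    be the diagonal matrix of the residual variances.

    Listing first the elements of a set closed under conditioning, then the
    rest, and decorrelating successively factors the exact normal density
    into one-dimensional normal factors; the factors outside of the closed set
    integrate out.  Hence the quotients defining the approximation telescope,
    its density is the product of the densities of [x_i] given [C i], and
    the residuals [W (x - mu)] are uncorrelated with covariance [D].  The
    covariance is thus [W^-1 D W^-T], and [L = W^-1 D^(1/2)] is its Cholesky
    factor.  Nestedness gives [L] the sparsity of [S], and the normal equations
    of the regressions show that [L L^T] agrees with [Sigma] on [S], which are
    the equations solved by the incomplete Cholesky recursion. *)

(** * Incomplete Cholesky decomposition *)

Section IncompleteCholesky.
Context {R : realType} {n : nat}.
Implicit Types A B L : 'M[R]_n.

Lemma trig_mulmx_trE L (i j : 'I_n) : is_trig_mx L ->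
  (L *m L^T) i j = \sum_(k < n | (k < j)%N) L i k * L j k + L i j * L j j.
Proof.
move=> /is_trig_mxP tL; rewrite mxE.
under eq_bigr do rewrite mxE.
rewrite (bigID (fun k : 'I_n => (k < j)%N)) /=; congr (_ + _).
rewrite (bigD1 j) ?ltnn//= big1 ?addr0// => k /andP[].
rewrite -leqNgt leq_eqVlt => /orP[/eqP/val_inj->|jk _]; first by rewrite eqxx.
by rewrite (tL j k jk) mulr0.
Qed.

Lemma take_enumS (m : nat) (mn : (m < n)%N) :
  take m.+1 (enum 'I_n) = rcons (take m (enum 'I_n)) (Ordinal mn).
Proof.
rewrite (take_nth (Ordinal mn)) ?size_enum_ord//; congr rcons.
by apply: val_inj => /=; rewrite nth_enum_ord.
Qed.

Lemma filter_enum_ord_lt (i : 'I_n) :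
  [seq j : 'I_n <- enum 'I_n | (j < i)%N] = take i (enum 'I_n).
Proof.
apply: (inj_map val_inj); rewrite map_take val_enum_ord take_iota.
rewrite -(filter_map val (fun k => (k < i)%N)) val_enum_ord.
have := ltnW (ltn_ord i); move: (nat_of_ord i) => m mn.
rewrite (minn_idPl mn) -[in LHS](subnKC mn).
rewrite iotaD filter_cat add0n.
have -> : [seq k <- iota 0 m | (k < m)%N] = iota 0 m.
  by apply/all_filterP/allP => k; rewrite mem_iota.
have -> : [seq k <- iota m (n - m) | (k < m)%N] = [::]; last by rewrite cats0.
apply/eqP; rewrite -[_ == _]negbK -has_filter; apply/hasPn => k.
by rewrite mem_iota -leqNgt => /andP[].
Qed.

(** Besides [L i j], the equation for [(L *m L^T) i j] involves only entries that the recursion has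
    already computed. A solution on [S] that vanishes off [S] is therefore reproduced entry by
    entry. *)
Lemma ichol_eq A (S : 'M[bool]_n) L :
  is_trig_mx L -> (forall i, 0 < L i i) ->
  (forall i j : 'I_n, (j < i)%N -> ~~ S i j -> L i j = 0) ->
  (forall i j : 'I_n, (j < i)%N -> S i j -> (L *m L^T) i j = A i j) ->
  (forall i, (L *m L^T) i i = A i i) ->
  ichol A S = L.
Proof.
move=> tL L0 LS0 LSA LA.
(* [rows m] is the state after [m] rows; [entries] gives the state inside row [i] after [m] of its
   columns. *)
pose rows m : 'M[R]_n := \matrix_(i, j) (if (i < m)%N then L i j else 0).
have entries (i : 'I_n) m : (m <= i)%N ->
    foldl (ichol_entry A S i) (rows i) (take m (enum 'I_n)) =
    \matrix_(a, b) (if (a < i)%N || (a == i) && (b < m)%N then L a b else 0).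
  elim: m => [_|m IH mi].
    by rewrite take0/=; apply/matrixP => a b; rewrite !mxE ltn0 andbF orbF.
  have mn := ltn_trans mi (ltn_ord i).
  rewrite (take_enumS mn) foldl_rcons (IH (ltnW mi)) /ichol_entry.
  set M := \matrix_(a, b) _; set j := Ordinal mn.
  have ME a b : M a b = if (a < i)%N || (a == i) && (b < m)%N then L a b else 0.
    by rewrite mxE.
  have -> : (if S i j then set_entry M i j
      ((A i j - \sum_(k < n | (k < j)%N) M i k * M j k) / M j j) else M) =
      set_entry M i j (L i j).
    case: ifPn => [Sij|/LS0 -> //]; last first.
      apply/matrixP => a b; rewrite [RHS]mxE; case: ifP => // /andP[/eqP-> /eqP->].
      by rewrite ME !ltnn andbF.
    congr set_entry; rewrite -LSA//.
    rewrite (trig_mulmx_trE _ _ tL).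
    have -> : \sum_(k < n | (k < j)%N) M i k * M j k =
        \sum_(k < n | (k < j)%N) L i k * L j k.
      by apply: eq_bigr => k kj; rewrite !ME eqxx mi/= [(k < m)%N]kj orbT.
    by rewrite ME mi/= addrAC subrr add0r mulfK// gt_eqF.
  apply/matrixP => a b; rewrite [LHS]mxE ME mxE ltnS.
  case: eqVneq => [->|ai]/=; last by rewrite !orbF.
  rewrite ltnn/=; case: eqVneq => [->|bj]/=; first by rewrite leqnn.
  by rewrite [(b <= m)%N]leq_eqVlt (_ : (b == m :> nat) = false)//; exact: negbTE bj.
have step m : (m <= n)%N -> foldl (ichol_row A S) 0 (take m (enum 'I_n)) = rows m.
  elim: m => [_|m IH mn]; first by rewrite take0; apply/matrixP => a b; rewrite !mxE.
  rewrite (take_enumS mn) foldl_rcons (IH (ltnW mn)) /ichol_row filter_enum_ord_lt.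
  set i := Ordinal mn; rewrite -[rows m]/(rows i) entries//.
  apply/matrixP => a b; rewrite !mxE ltnS.
  (* The root is [L i i] itself because the diagonal is positive. *)
  rewrite (_ : Num.sqrt _ = L i i); last first.
    rewrite (eq_bigr (fun k => L i k * L i k)); last first.
      by move=> k ki; rewrite mxE eqxx ki orbT expr2.
    rewrite -LA (trig_mulmx_trE _ _ tL) addrAC subrr add0r -expr2.
    by rewrite sqrtr_sqr gtr0_norm.
  rewrite [(a <= m)%N]leq_eqVlt -[(nat_of_ord a == m)]/(a == i).
  case: (eqVneq a i) => [->|ai]/=; last by rewrite orbF.
  case: (eqVneq b i) => [->//|bi]; rewrite ltnn /=.
  case: ltnP => // ib; move/is_trig_mxP: tL => ->//.
  by rewrite ltn_neqAle ib andbT eq_sym.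
rewrite /ichol -[enum 'I_n]take_size size_enum_ord step//.
by apply/matrixP => a b; rewrite mxE ltn_ord.
Qed.

(* Column by column: the entries in column [j] are determined by [A] and the
   columns on the left. *)
Lemma is_chol_inj A B L : is_chol A B -> is_chol A L -> B = L.
Proof.
move=> [tB B0 BA] [tL L0 LA].
suff H (j i : 'I_n) : B i j = L i j by apply/matrixP => i j.
move: i; have [m jm] := ubnP (nat_of_ord j); elim: m j jm => // m IH j jm i.
have E (k : 'I_n) : \sum_(l < n | (l < j)%N) B k l * B j l =
    \sum_(l < n | (l < j)%N) L k l * L j l.
  by apply: eq_bigr => l lj; rewrite !IH// (leq_trans lj).
have D (k : 'I_n) : B k j * B j j = L k j * L j j.
  apply: (addrI (\sum_(l < n | (l < j)%N) B k l * B j l)).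
  by rewrite {2}E -!trig_mulmx_trE// BA LA.
have jj : B j j = L j j.
  by apply/eqP; rewrite -(@eqrXn2 _ 2) ?ltW// !expr2 D.
by apply: (mulIf (lt0r_neq0 (B0 j))); rewrite D jj.
Qed.

Lemma cholE A L : is_chol A L -> chol A = L.
Proof.
move=> AL; rewrite /chol; case: xgetP => [B _ AB|]; first exact: is_chol_inj AB AL.
by move=> /(_ L).
Qed.

(** The quadratic form at [v] is the squared norm of [L^T *m v], and [L] is invertible by its
    positive diagonal. *)
Lemma is_chol_posdefmx A L : is_chol A L -> posdefmx A.
Proof.
move=> [tL L0 <-]; split=> [|v v0]; first by rewrite trmx_mul trmxK.
have Lu : L \in unitmx.
  rewrite unitmxE unitfE det_trig//; apply/prodf_neq0 => i _; exact: lt0r_neq0.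
rewrite mulmxA -mulmxA -[v^T *m L](trmxK) trmx_mul trmxK.
set w := L^T *m v.
have w0 : w != 0.
  apply: contraNneq v0 => w0; rewrite -[v]mul1mx -(@mulVmx _ _ L^T) ?unitmx_tr//.
  by rewrite -mulmxA -/w w0 mulmx0.
have [i wi] : exists i, w i 0 != 0.
  apply/existsP; apply: contraNT w0; rewrite negb_exists => /forallP w0.
  apply/eqP/colP => i; have /negPn/eqP -> := w0 i.
  by rewrite mxE.
rewrite mxE (bigD1 i)//= mxE ltr_wpDr// ?sumr_ge0// => [j _|].
  by rewrite mxE -expr2 sqr_ge0.
by rewrite -expr2 exprn_even_gt0.
Qed.

End IncompleteCholesky.

(** * Regression residuals *)

Section Residuals.
Context {R : realType} {n : nat} (Sigma : 'M[R]_n).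
Implicit Types (B : {set 'I_n}) (C : 'I_n -> {set 'I_n}).

(** Multiplying a row [v] by this matrix gives [v *m Sigma] on [B] and [v] off [B]. One full-size
    system thus encodes the regression on [B]: normal equations on [B], zero coefficients
    elsewhere. *)
Definition regress_mx B : 'M[R]_n :=
  \matrix_(l, k) if k \in B then Sigma l k else (l == k)%:R.

(** Coefficients of [x_i] minus its best linear predictor from [x_B]. *)
Definition resid B (i : 'I_n) : 'rV[R]_n :=
  delta_mx 0 i -
  (\row_k if k \in B then Sigma i k else 0) *m invmx (regress_mx B).

Definition cond_var B (i : 'I_n) : R :=
  (resid B i *m Sigma *m (resid B i)^T) 0 0.

Definition resid_mx C : 'M[R]_n := \matrix_(i, j) resid (C i) i 0 j.

Lemma trmxE m p (A : 'M[R]_(m, p)) i j : A^T i j = A j i.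
Proof. by rewrite mxE. Qed.

Lemma mxBE m p (A B : 'M[R]_(m, p)) i j : (A - B) i j = A i j - B i j.
Proof. by rewrite !mxE. Qed.

Lemma row_resid_mx C i : row i (resid_mx C) = resid (C i) i.
Proof. by apply/rowP => j; rewrite !mxE. Qed.

Lemma resid_mxM C p (A : 'M[R]_(n, p)) i j :
  (resid_mx C *m A) i j = (resid (C i) i *m A) 0 j.
Proof. by rewrite -row_resid_mx -row_mul [RHS]mxE. Qed.

Lemma resid_mxE C i j : resid_mx C i j = resid (C i) i 0 j.
Proof. by rewrite mxE. Qed.

Hypothesis Spd : posdefmx Sigma.

Lemma posdefmx_row_gt0 (v : 'rV[R]_n) : v != 0 -> 0 < (v *m Sigma *m v^T) 0 0.
Proof. by move=> v0; have := Spd.2 v^T; rewrite trmxK trmx_eq0 => ->. Qed.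

Lemma mul_regress_mx (v : 'rV[R]_n) B k :
  (v *m regress_mx B) 0 k = if k \in B then (v *m Sigma) 0 k else v 0 k.
Proof.
rewrite mxE; case: ifPn => kB.
  by rewrite mxE; apply: eq_bigr => l _; rewrite mxE kB.
rewrite (bigD1 k)//= mxE (negbTE kB) eqxx mulr1 big1 ?addr0// => l lk.
by rewrite mxE (negbTE kB) (negbTE lk) mulr0.
Qed.

(** A row in the kernel vanishes off [B] while its product with [Sigma] vanishes on [B], so its
    quadratic form is zero. *)
Lemma regress_mx_unit B : regress_mx B \in unitmx.
Proof.
rewrite unitmxE unitfE; apply/negP => /det0P[v v0 vB].
have := posdefmx_row_gt0 v0; rewrite mxE big1 ?ltxx// => k _.
have := mul_regress_mx v B k; rewrite vB trmxE (_ : (0 : 'rV[R]_n) 0 k = 0) ?mxE//.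
by case: ifPn => kB <-; rewrite ?mul0r ?mulr0.
Qed.

(** These are the normal equations of the regression on [B]. *)
Lemma resid_orth B i k : k \in B -> (resid B i *m Sigma) 0 k = 0.
Proof.
move=> kB; rewrite mulmxBl -rowE; set u : 'rV_n := \row_(_ < n) _.
have := mul_regress_mx (u *m invmx (regress_mx B)) B k.
rewrite mulmxKV ?regress_mx_unit// kB => uk.
by rewrite mxBE -uk !mxE kB subrr.
Qed.

Lemma resid_notin B i k : k \notin B -> resid B i 0 k = (k == i)%:R.
Proof.
move=> kB; rewrite /resid; set u : 'rV_n := \row_(_ < n) _.
have := mul_regress_mx (u *m invmx (regress_mx B)) B k.
rewrite mulmxKV ?regress_mx_unit// (negbTE kB) => uk.
by rewrite mxBE -uk !mxE (negbTE kB) subr0 eqxx.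
Qed.

Lemma cond_var_gt0 B i : i \notin B -> 0 < cond_var B i.
Proof.
move=> iB; apply: posdefmx_row_gt0; apply/eqP => /rowP/(_ i).
by rewrite resid_notin// eqxx mxE => /eqP; rewrite oner_eq0.
Qed.

(** The residual and [x_i] differ by a combination of [x_B], with which the residual is
    uncorrelated. *)
Lemma cond_varE B i : i \notin B -> (resid B i *m Sigma) 0 i = cond_var B i.
Proof.
move=> iB; rewrite /cond_var [RHS]mxE (bigD1 i)//=.
rewrite [_^T _ _]mxE resid_notin// eqxx mulr1 big1 ?addr0// => k ki.
have [kB|kB] := boolP (k \in B).
  by rewrite resid_orth// mul0r.
by rewrite [_^T _ _]mxE resid_notin// (negbTE ki) mulr0.
Qed.

(** * Successive decorrelation along an injective rank *)

Section Rank.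
Variable rank : 'I_n -> nat.
Hypothesis rank_inj : injective rank.

Definition rank_pred (i : 'I_n) : {set 'I_n} := [set k | (rank k < rank i)%N].

Lemma rank_predN i : i \notin rank_pred i.
Proof. by rewrite inE ltnn. Qed.

(* A permutation that never increases an injective rank is the identity. *)
Lemma det_resid_mx_rank : \det (resid_mx rank_pred) = 1.
Proof.
rewrite /determinant (bigD1 (1%g : {perm 'I_n}))//= odd_perm1 mul1r.
rewrite [X in X + _]big1 => [|i _]; last first.
  by rewrite perm1 resid_mxE resid_notin ?rank_predN// eqxx.
rewrite big1 ?addr0// => s s1; apply/eqP; rewrite mulf_eq0 prodf_seq_eq0.
apply/orP; right; apply: contraNT s1; rewrite -all_predC => /allP H.
have le i : (rank (s i) <= rank i)%N.
  have := H i (mem_index_enum _); rewrite /= resid_mxE.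
  have [/= + _|+] := boolP (s i \in rank_pred i); first by rewrite inE => /ltnW.
  by move/resid_notin => ->; case: (s i =P i) => [->//|_]; rewrite eqxx.
(* Permuting leaves the sum of the ranks unchanged, so equality holds in every term. *)
have /leqif_sum[_] : forall i, true ->
    (rank (s i) <= rank i ?= iff (rank (s i) == rank i))%N.
  by move=> i _; split.
rewrite /= [X in (X == _)%N](reindex_inj (@perm_inj _ s^-1%g))/=.
have -> : (\sum_(j < n) rank (s (s^-1 j)%g) = \sum_(j < n) rank j)%N.
  by apply: eq_bigr => j _; rewrite permKV.
rewrite eqxx => /esym/forallP E; apply/eqP/permP => i; rewrite perm1.
exact/rank_inj/eqP/E.
Qed.

(** The residual of [i] is uncorrelated with every coordinate of smaller rank, and the residual of
    such a [j] combines only coordinates of rank at most that of [j]. Symmetry covers the other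
    triangle. *)
Lemma resid_mx_rank_diag :
  resid_mx rank_pred *m Sigma *m (resid_mx rank_pred)^T =
  diag_mx (\row_i cond_var (rank_pred i) i).
Proof.
have Slt (i j : 'I_n) : (rank j < rank i)%N ->
    (resid_mx rank_pred *m Sigma *m (resid_mx rank_pred)^T) i j = 0.
  move=> ji; rewrite mxE big1// => k _; rewrite resid_mxM [_^T _ _]mxE resid_mxE.
  have [kj|jk] := leqP (rank k) (rank j).
    by rewrite resid_orth ?mul0r// inE (leq_ltn_trans kj).
  rewrite resid_notin ?inE -?leqNgt 1?ltnW//.
  by case: eqVneq jk => [->|]; rewrite ?ltnn// mulr0.
apply/matrixP => i j; rewrite [RHS]mxE [in RHS]mxE; case: eqVneq => [<-|ij].
  rewrite mulr1n /cond_var !mxE; apply: eq_bigr => k _.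
  by rewrite resid_mxM ![_^T _ _]mxE resid_mxE [(resid _ _ *m _) _ _]mxE.
rewrite mulr0n; have [/Slt//|ij'|/rank_inj ij'] := ltngtP (rank j) (rank i); last first.
  by rewrite ij' eqxx in ij.
rewrite -(Slt _ _ ij') -[LHS]trmxE; congr (fun_of_matrix _ j i).
by rewrite !trmx_mul trmxK Spd.1 mulmxA.
Qed.

Lemma det_rank : \det Sigma = \prod_i cond_var (rank_pred i) i.
Proof.
have /(congr1 determinant) := resid_mx_rank_diag.
rewrite !det_mulmx det_tr det_resid_mx_rank mul1r mulr1 det_diag => ->.
by apply: eq_bigr => i _; rewrite mxE.
Qed.

(** Inverting [W *m Sigma *m W^T = D] gives [W^T *m D^-1 *m W] for the inverse of [Sigma]; [E] is
    [D^-1]. *)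
Lemma invmx_quad_rank (z : 'cV[R]_n) :
  (z^T *m invmx Sigma *m z) 0 0 =
  \sum_i (resid (rank_pred i) i *m z) 0 0 ^+ 2 / cond_var (rank_pred i) i.
Proof.
set W := resid_mx rank_pred.
have Wu : W \in unitmx by rewrite unitmxE det_resid_mx_rank unitr1.
pose E : 'M[R]_n := diag_mx (\row_i (cond_var (rank_pred i) i)^-1).
have SV : invmx Sigma = W^T *m E *m W.
  have H : Sigma *m (W^T *m E *m W) = 1%:M.
    rewrite -[LHS](mulKmx Wu) !mulmxA -[_ *m W *m Sigma *m _]mulmxA.
    rewrite -!mulmxA [W *m _]mulmxA [W *m Sigma *m _]mulmxA resid_mx_rank_diag.
    rewrite [diag_mx _ *m (E *m W)]mulmxA mulmx_diag.
    rewrite (_ : \row_j _ = const_mx 1); last first.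
      by apply/rowP => j; rewrite !mxE divff// lt0r_neq0// cond_var_gt0 ?rank_predN.
    by rewrite diag_const_mx mul1mx mulVmx.
  have [Su _] := mulmx1_unit H.
  by rewrite -[RHS](mulKmx Su) H mulmx1.
rewrite SV -!mulmxA !mulmxA -trmx_mul -[_ *m W *m z]mulmxA mxE.
apply: eq_bigr => i _.
have -> : ((W *m z)^T *m E) 0 i = (W *m z) i 0 * (cond_var (rank_pred i) i)^-1.
  by rewrite mul_mx_diag !mxE.
by rewrite resid_mxM expr2 mulrAC.
Qed.
End Rank.

(** * The Cholesky factor for nested conditioning sets *)

Section NestedConditioning.
Variable C : 'I_n -> {set 'I_n}.
Hypothesis C_lt : forall i j, j \in C i -> (j < i)%N.
Hypothesis C_nested : forall i j, j \in C i -> C j = [set k in C i | (k < j)%N].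

Let notinC (i j : 'I_n) : (i <= j)%N -> j \notin C i.
Proof. by move=> ij; apply/negP => /C_lt; rewrite ltnNge ij. Qed.

Let Cii i : i \notin C i. Proof. exact: notinC. Qed.

Lemma resid_mx_trig : is_trig_mx (resid_mx C).
Proof.
apply/is_trig_mxP => i j ij; rewrite resid_mxE resid_notin; last exact/notinC/ltnW.
by rewrite -val_eqE/= gtn_eqF.
Qed.

Lemma resid_mx_unit : resid_mx C \in unitmx.
Proof.
rewrite unitmxE det_trig ?resid_mx_trig// big1 ?unitr1// => i _.
by rewrite resid_mxE resid_notin ?eqxx.
Qed.

Definition hv_chol : 'M[R]_n :=
  invmx (resid_mx C) *m diag_mx (\row_i Num.sqrt (cond_var (C i) i)).

Let M := invmx (resid_mx C).

Lemma inv_resid_mx_rec i j :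
  M i j = (i == j)%:R - \sum_(k in C i) resid (C i) i 0 k * M k j.
Proof.
have : (resid_mx C *m M) i j = (i == j)%:R by rewrite mulmxV ?resid_mx_unit// mxE.
rewrite mxE (bigID [in C i])/= => <-; rewrite addrAC.
rewrite [X in X - _](eq_bigr (fun k => resid (C i) i 0 k * M k j)); last first.
  by move=> k _; rewrite resid_mxE.
rewrite subrr add0r (bigD1 i)//= resid_mxE resid_notin// eqxx mul1r.
rewrite big1 ?addr0// => k /andP[kC ki].
by rewrite resid_mxE resid_notin// (negbTE ki) mul0r.
Qed.

(** Strong induction on [i]: each [k] in [C i] differs from [j], and [C k] lies inside [C i] by
    nestedness, so it misses [j] too. This gives the sparsity of the Cholesky factor. *)
Lemma inv_resid_mx_eq0 i j : i != j -> j \notin C i -> M i j = 0.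
Proof.
have [m im] := ubnP (nat_of_ord i); elim: m i im => // m IH i im ij jC.
rewrite inv_resid_mx_rec (negbTE ij) big1 ?subr0// => k kC.
rewrite IH ?mulr0//; first exact: leq_trans (C_lt kC) _.
  by apply: contraNneq jC => <-.
by apply: contra jC; rewrite (C_nested kC) inE => /andP[].
Qed.

Lemma inv_resid_mx_diag i : M i i = 1.
Proof.
rewrite inv_resid_mx_rec eqxx big1 ?subr0// => k kC.
rewrite inv_resid_mx_eq0 ?mulr0//; last exact/notinC/ltnW/C_lt.
by apply: contraTneq kC => ->.
Qed.

Lemma hv_cholE i j : hv_chol i j = M i j * Num.sqrt (cond_var (C j) j).
Proof. by rewrite /hv_chol mul_mx_diag !mxE. Qed.

Lemma hv_chol_trig : is_trig_mx hv_chol.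
Proof.
apply/is_trig_mxP => i j ij; rewrite hv_cholE inv_resid_mx_eq0 ?mul0r//.
  by rewrite -val_eqE/= ltn_eqF.
exact/notinC/ltnW.
Qed.

Lemma hv_chol_gt0 i : 0 < hv_chol i i.
Proof. by rewrite hv_cholE inv_resid_mx_diag mul1r sqrtr_gt0 cond_var_gt0 ?Cii. Qed.

(** With [W = resid_mx C], this is [W *m (W^-1 *m D *m W^-T) = D *m W^-T]. *)
Lemma resid_mx_hv_chol i j :
  (resid_mx C *m (hv_chol *m hv_chol^T)) i j = cond_var (C i) i * M j i.
Proof.
rewrite mulmxA /hv_chol mulKVmx ?resid_mx_unit// trmx_mul tr_diag_mx.
rewrite mulmxA mulmx_diag mul_diag_mx mxE trmxE; congr (_ * _).
by rewrite !mxE -expr2 sqr_sqrtr// ltW// cond_var_gt0.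
Qed.

(* Row [i] of [resid_mx C] annihilates the columns in [C i] of both matrices,
   so the entries in row [i] are the same combinations of earlier ones. *)
Lemma hv_cholM_eq i j : (j \in C i) || (i == j) ->
  (hv_chol *m hv_chol^T) i j = Sigma i j.
Proof.
set K := hv_chol *m hv_chol^T.
have Ksym a b : K a b = K b a by rewrite -[LHS]trmxE trmx_mul trmxK.
have Ssym a b : Sigma a b = Sigma b a by rewrite -[LHS]trmxE Spd.1.
have rowE (A : 'M[R]_n) i' j' : (resid_mx C *m A) i' j' =
    A i' j' + \sum_(k in C i') resid (C i') i' 0 k * A k j'.
  rewrite mxE (bigID [in C i'])/= addrC (bigD1 i')//= resid_mxE resid_notin//.
  rewrite eqxx mul1r big1 ?addr0 => [|k /andP[kC ki]]; last first.
    by rewrite resid_mxE resid_notin// (negbTE ki) mul0r.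
  by congr (_ + _); apply: eq_bigr => k _; rewrite resid_mxE.
(* For [j'] in [C i'] both row products vanish, by triangularity of [M] for [K] and by the normal
   equations for [Sigma]; for [j' = i'] both are the residual variance. *)
have step i' j' : (j' \in C i') || (i' == j') ->
    {in C i', forall k, K k j' = Sigma k j'} -> K i' j' = Sigma i' j'.
  move=> ij' H; apply: (addIr (\sum_(k in C i') resid (C i') i' 0 k * K k j')).
  rewrite -rowE [in RHS](eq_bigr (fun k => resid (C i') i' 0 k * Sigma k j')); last first.
    by move=> k kC; rewrite H.
  rewrite -rowE resid_mx_hv_chol resid_mxM.
  case/orP: ij' => [jC|/eqP <-]; last by rewrite inv_resid_mx_diag mulr1 cond_varE ?Cii.
  rewrite resid_orth// inv_resid_mx_eq0 ?mulr0//; last exact/notinC/ltnW/C_lt.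
  by apply: contraTneq jC => ->.
have [m im] := ubnP (nat_of_ord i); elim: m i j im => // m IH i j im.
(* For distinct [k] and [l] in [C i], nestedness puts the smaller one in the conditioning set of the
   larger, so the induction hypothesis applies. *)
have off k : k \in C i -> K i k = Sigma i k.
  move=> kC; apply: step => [|l lC]; first by rewrite kC.
  have [km lm] := (leq_trans (C_lt kC) im, leq_trans (C_lt lC) im).
  case: (ltngtP k l) => [kl|lk|/val_inj ->]; last by rewrite IH// eqxx orbT.
    by rewrite IH// (C_nested lC) inE kC kl.
  by rewrite Ksym Ssym IH// (C_nested kC) inE lC lk.
case/orP => [/off//|/eqP<-]; apply: step => [|k kC]; first by rewrite eqxx orbT.
by rewrite Ksym Ssym off.
Qed.
End NestedConditioning.
End Residuals.

(** * Moments of the normal density *)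

Section NormalMoments.
Context {R : realType}.
Variables (m s : R).
Hypothesis s0 : 0 < s.
Let mu := @lebesgue_measure R.
Let N := normal_pdf m s.

Lemma normal_pdf_shift (m' t : R) : normal_pdf m' s t = normal_pdf 0 s (t - m').
Proof. by rewrite !normal_pdfE ?gt_eqF// /normal_fun subr0. Qed.

Lemma normal_pdf_gt0 (m' t : R) : 0 < normal_pdf m' s t.
Proof.
by rewrite normal_pdfE ?gt_eqF// mulr_gt0 ?normal_peak_gt0 ?gt_eqF// expR_gt0.
Qed.

(* [1 + x <= expR x] at the logarithm of the ratio of two normal densities *)
Lemma normal_pdf_ge (m' c t : R) : 0 < c ->
  N t * (1 + ((t - m) ^+ 2 / s ^+ 2 - (t - m') ^+ 2 / (c * s) ^+ 2) / 2) <=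
  c * normal_pdf m' (c * s) t.
Proof.
move=> c0; rewrite /N !normal_pdfE ?gt_eqF ?mulr_gt0//.
have -> : normal_peak s = c * normal_peak (c * s).
  have E (z : R) : 0 < z -> normal_peak z = (z * Num.sqrt (pi *+ 2))^-1.
    by move=> z0; rewrite /normal_peak -mulrnAr sqrtrM ?sqr_ge0// sqrtr_sqr gtr0_norm.
  by rewrite !E ?mulr_gt0// -mulrA [in RHS]invfM mulrA divff ?mul1r// gt_eqF.
rewrite -!mulrA ler_pM2l// ler_pM2l ?normal_peak_gt0 ?gt_eqF ?mulr_gt0//.
set u := (_ - _) / 2.
have -> : normal_fun m' (c * s) t = normal_fun m s t * expR u.
  rewrite /normal_fun -expRD; congr expR; rewrite /u !mulNr.
  by rewrite -!(mulr_natr (_ ^+ 2) 2) !invfM; lra.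
by rewrite ler_pM2l ?expR_gt0// expR_ge1Dx.
Qed.

Let mN : measurable_fun [set: R] N.
Proof. exact: measurable_normal_pdf. Qed.

Let mX k : measurable_fun [set: R] (fun t => (t - m) ^+ k).
Proof. by apply: measurable_funX; exact: measurable_funB. Qed.

Let mf k : measurable_fun [set: R] (fun t => N t * (t - m) ^+ k).
Proof. exact: measurable_funM. Qed.

Let f k (t : R) := N t * (t - m) ^+ k.

Let i0 : mu.-integrable [set: R] (EFin \o f 0).
Proof.
have -> : EFin \o f 0 = EFin \o N by apply/funext => t; rewrite /f /= expr0 mulr1.
exact: integrable_normal_pdf.
Qed.

Let i2 : mu.-integrable [set: R] (EFin \o f 2).
Proof.
(* Let [q] be the normalized square. Comparison with scale [2 * s] bounds [N * (1 + 3 / 8 * q)] by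
   twice the wider density, whence the constant. *)
apply: (@le_integrable _ _ _ mu _ _ _
    (EFin \o (fun t => (8 / 3 * s ^+ 2 * 2) * normal_pdf m (2 * s) t))) => //.
- by apply/measurable_EFinP; exact: mf.
- move=> t _ /=; rewrite lee_fin !ger0_norm; last 2 first.
  + by rewrite !mulr_ge0 ?normal_pdf_ge0 ?sqr_ge0// ltW.
  + by rewrite mulr_ge0 ?normal_pdf_ge0 ?sqr_ge0.
  have := @normal_pdf_ge m 2 t ltac:(lra); have := normal_pdf_ge0 m s t.
  rewrite -/(N t) /f; set n2 := normal_pdf m (2 * s) t; move: (N t) => z z0.
  have -> : ((t - m) ^+ 2 / s ^+ 2 - (t - m) ^+ 2 / (2 * s) ^+ 2) / 2 =
      3 / 8 * ((t - m) ^+ 2 / s ^+ 2) by field; rewrite gt_eqF.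
  have s2 : 0 < s ^+ 2 by rewrite exprn_gt0.
  rewrite -[(t - m) ^+ 2 in X in _ -> X](divfK (lt0r_neq0 s2)).
  move: ((t - m) ^+ 2 / s ^+ 2) => q zq.
  have : (z * q) * s ^+ 2 <= (8 / 3 * 2 * n2) * s ^+ 2 by rewrite ler_pM2r//; lra.
  lra.
- have -> : (EFin \o (fun t => 8 / 3 * s ^+ 2 * 2 * normal_pdf m (2 * s) t)) =
      (fun t => (8 / 3 * s ^+ 2 * 2)%:E * (normal_pdf m (2 * s) t)%:E)%E.
    by apply/funext => t /=; rewrite EFinM.
  by apply: integrableZl => //; exact: integrable_normal_pdf.
Qed.

Let i1 : mu.-integrable [set: R] (EFin \o f 1).
Proof.
(* The domination is [|u| <= 1 + u ^+ 2]. *)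
apply: (@le_integrable _ _ _ mu _ _ _ ((EFin \o f 0) \+ (EFin \o f 2))%E) => //.
- by apply/measurable_EFinP; exact: mf.
- move=> t _ /=; rewrite lee_fin -/N /f expr0 mulr1 expr1.
  rewrite normrM [`|N t|]ger0_norm ?normal_pdf_ge0//.
  rewrite -[X in X + _ * _]mulr1 -mulrDr normrM [`|N t|]ger0_norm ?normal_pdf_ge0//.
  rewrite ler_wpM2l ?normal_pdf_ge0// [leRHS]ger0_norm ?addr_ge0 ?sqr_ge0//.
  rewrite -[(t - m) ^+ 2]real_normK ?num_real//.
  by have := sqr_ge0 (`|t - m| - 1); have := normr_ge0 (t - m); nra.
- exact: integrableD.
Qed.

Let I k := (\int[mu]_t f k t)%R.

Let int_poly (p0 p1 p2 : R) :
  mu.-integrable [set: R]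
    (EFin \o (fun t => N t * (p0 + p1 * (t - m) + p2 * (t - m) ^+ 2))) /\
  (\int[mu]_t (N t * (p0 + p1 * (t - m) + p2 * (t - m) ^+ 2)))%R =
  p0 + p1 * I 1 + p2 * I 2.
Proof.
have iZ c k : mu.-integrable [set: R] (EFin \o f k) ->
    mu.-integrable [set: R] (EFin \o (fun t => c * f k t)).
  by move=> ik; exact: (integrableZl measurableT c ik).
have iD (g h : R -> R) : mu.-integrable [set: R] (EFin \o g) ->
    mu.-integrable [set: R] (EFin \o h) ->
    mu.-integrable [set: R] (EFin \o (fun t => g t + h t)).
  by move=> ig ih; exact: (integrableD measurableT ig ih).
have -> : (fun t => N t * (p0 + p1 * (t - m) + p2 * (t - m) ^+ 2)) =
    (fun t => (p0 * f 0 t + p1 * f 1 t) + p2 * f 2 t).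
  by apply/funext => t; rewrite /f; ring.
have i01 := iD _ _ (iZ p0 _ i0) (iZ p1 _ i1).
split; first exact: (iD _ _ i01 (iZ p2 _ i2)).
rewrite (RintegralD measurableT i01 (iZ p2 2 i2)).
rewrite (RintegralD measurableT (iZ p0 0 i0) (iZ p1 1 i1)).
rewrite !RintegralZl//; congr (_ + _ + _).
rewrite (_ : f 0 = N); last by apply/funext => t; rewrite /f expr0 mulr1.
by rewrite /Rintegral integral_normal_pdf mulr1.
Qed.

(** Comparison with the density shifted by [d] bounds [d * I 1] by [d ^+ 2 / 2]; taking [d = I 1]
    forces [I 1 = 0]. *)
Let I1 : I 1 = 0.
Proof.
have H d : d * I 1 <= d ^+ 2 / 2.
  have [ip ep] := int_poly (1 - d ^+ 2 / s ^+ 2 / 2) (d / s ^+ 2) 0.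
  have : \int[mu]_t (N t * (1 - d ^+ 2 / s ^+ 2 / 2 + d / s ^+ 2 * (t - m) +
      0 * (t - m) ^+ 2)) <= \int[mu]_t normal_pdf (m + d) s t.
    apply: le_Rintegral => //; first exact: integrable_normal_pdf.
    move=> t _; have := @normal_pdf_ge (m + d) 1 t ltac:(lra).
    rewrite !mul1r; apply: le_trans; rewrite le_eqVlt; apply/orP; left.
    by apply/eqP; congr (_ * _); field; rewrite gt_eqF.
  rewrite ep [X in _ <= X]/Rintegral integral_normal_pdf/= mul0r addr0 => le1.
  have s2 : 0 < s ^+ 2 by rewrite exprn_gt0.
  have : (d * I 1) / s ^+ 2 <= (d ^+ 2 / 2) / s ^+ 2 by lra.
  by rewrite ler_pM2r// invr_gt0.
have := H (I 1); have := sqr_ge0 (I 1); rewrite -expr2 => ? ?.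
by apply/eqP; rewrite -sqrf_eq0; apply/eqP; lra.
Qed.

(** Comparison with scale [c * s] constrains the normalized variance [V] for every positive [c],
    with equality at [c = 1]; this pins [V] to 1. *)
Let I2 : I 2 = s ^+ 2.
Proof.
have s2 : 0 < s ^+ 2 by rewrite exprn_gt0.
pose V := I 2 / s ^+ 2.
have V0 : 0 <= V.
  rewrite divr_ge0 ?(ltW s2)//; apply: Rintegral_ge0 => t _.
  by rewrite mulr_ge0 ?normal_pdf_ge0 ?sqr_ge0.
have H c : 0 < c -> 1 + V * (1 - c ^- 2) / 2 <= c.
  move=> c0; pose p2 := (1 - c ^- 2) / s ^+ 2 / 2.
  have [ip ep] := int_poly 1 0 p2.
  have : \int[mu]_t (N t * (1 + 0 * (t - m) + p2 * (t - m) ^+ 2)) <=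
      \int[mu]_t (c * normal_pdf m (c * s) t).
    apply: le_Rintegral => //.
      exact: (integrableZl measurableT c (integrable_normal_pdf m (c * s))).
    move=> t _; have := @normal_pdf_ge m c t c0.
    apply: le_trans; rewrite le_eqVlt; apply/orP; left.
    by apply/eqP; congr (_ * _); rewrite /p2; field; rewrite !gt_eqF.
  rewrite ep RintegralZl//; last exact: integrable_normal_pdf.
  rewrite [X in _ <= _ * X]/Rintegral integral_normal_pdf/= mulr1 mul0r addr0.
  apply: le_trans; rewrite le_eqVlt; apply/orP; left; apply/eqP.
  by rewrite /V/p2; field; rewrite !gt_eqF.
suff V1 : V = 1 by rewrite -[LHS](divfK (lt0r_neq0 s2)) -/V V1 mul1r.
(* with [c = (V + 1) / 2] the bound becomes [(c - 1) ^+ 2 <= 0] *)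
pose c := (V + 1) / 2.
have c0 : 0 < c by rewrite /c; lra.
have Vc : V = 2 * c - 1 by rewrite /c; lra.
have := H c c0; rewrite Vc => Hc.
have c2 : 0 < c ^+ 2 by rewrite exprn_gt0.
have : (1 + (2 * c - 1) * (1 - c ^- 2) / 2) * c ^+ 2 <= c * c ^+ 2 by rewrite ler_pM2r.
have -> : (1 + (2 * c - 1) * (1 - c ^- 2) / 2) * c ^+ 2 =
    c ^+ 2 + (2 * c - 1) * (c ^+ 2 - 1) / 2 by field; rewrite gt_eqF.
move=> {}Hc; have : (c - 1) ^+ 2 <= 0 by nra.
by rewrite real_exprn_even_le0 ?num_real//= => /eqP; lra.
Qed.

(** The shape is that of one step of the iterated integral: an outer factor [c], the part of the
    square linear in the current variable, and the variance [e] already integrated. *)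
Lemma integral_normal_pdf_quad (c a b e : R) :
  (\int[lebesgue_measure]_t (c * (N t * ((a + b * (t - m)) ^+ 2 + e)))%:E =
  (c * (a ^+ 2 + b ^+ 2 * s ^+ 2 + e))%:E)%E.
Proof.
have [ip ep] := int_poly (c * (a ^+ 2 + e)) (c * (2 * a * b)) (c * b ^+ 2).
set g := fun t => (_)%:E.
have -> : g = EFin \o (fun t => N t * (c * (a ^+ 2 + e) +
    c * (2 * a * b) * (t - m) + c * b ^+ 2 * (t - m) ^+ 2)).
  by apply/funext => t /=; congr EFin; ring.
rewrite -[LHS]fineK ?integrable_fin_num//; congr EFin.
transitivity (c * (a ^+ 2 + e) + c * (2 * a * b) * I 1 + c * b ^+ 2 * I 2).
  exact: ep.
by rewrite I1 I2; ring.
Qed.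

End NormalMoments.

(** * Iterated integrals of normal factors *)

Section IteratedNormal.
Context {R : realType} {n : nat} (mu : 'cV[R]_n).
Implicit Types (x : n.-tuple R) (r : 'rV[R]_n) (B : {set 'I_n}).

Definition centered_form r x : R := (r *m (\col_i tnth x i - mu)) 0 0.

Lemma centered_form_set_coord r x k t :
  centered_form r (set_coord x k t) = centered_form r x + r 0 k * (t - tnth x k).
Proof.
rewrite /centered_form !mxE (bigD1 k)//= [in RHS](bigD1 k)//= !mxE tnth_mktuple eqxx.
rewrite addrAC; congr (_ + _); first ring.
by apply: eq_bigr => i ik; rewrite !mxE tnth_mktuple (negbTE ik).
Qed.

(* The last integration variable in [s] occurs in a single factor, so the
   factors integrate out one after the other, from the innermost on. *)
Lemma integrate_out_normal (r : 'I_n -> 'rV[R]_n) (sd w : 'I_n -> R)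
    (s : seq 'I_n) (G u : n.-tuple R -> R) x :
  (forall k, 0 < sd k) -> (forall k, r k 0 k = 1) ->
  pairwise (fun k l => r k 0 l == 0) s ->
  (forall y k t, k \in s -> G (set_coord y k t) = G y) ->
  (forall y k t, k \in s -> u (set_coord y k t) = u y) ->
  integrate_out s (fun y =>
    (G y * (u y + \sum_(i <- s) w i * centered_form (r i) y) ^+ 2 *
     \prod_(i <- s) normal_pdf 0 (sd i) (centered_form (r i) y))%:E) x =
  (G x * (u x ^+ 2 + \sum_(i <- s) w i ^+ 2 * sd i ^+ 2))%:E.
Proof.
move=> sd0 r1; elim: s G u x => [|k s IH] G u x /=.
  by move=> _ _ _; rewrite !big_nil !addr0 mulr1.
move=> /andP[/allP rk rs] Gs us.
pose f y := normal_pdf 0 (sd k) (centered_form (r k) y).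
(* The form [r k] involves no coordinate in [s], so its density joins [G] and its linear term joins
   [u] before the induction hypothesis is used. *)
pose G' y := G y * f y; pose u' y := u y + w k * centered_form (r k) y.
have E : (fun y => (G y * (u y + \sum_(i <- k :: s) w i * centered_form (r i) y) ^+ 2 *
     \prod_(i <- k :: s) normal_pdf 0 (sd i) (centered_form (r i) y))%:E) =
   (fun y => (G' y * (u' y + \sum_(i <- s) w i * centered_form (r i) y) ^+ 2 *
     \prod_(i <- s) normal_pdf 0 (sd i) (centered_form (r i) y))%:E).
  by apply/funext => y; rewrite !big_cons /G' /u' /f; congr EFin; ring.
rewrite E.
have r0 y l t : l \in s ->
    centered_form (r k) (set_coord y l t) = centered_form (r k) y.
  by move=> /rk/eqP rkl; rewrite centered_form_set_coord rkl mul0r addr0.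
under eq_integral => t _.
  rewrite IH//; last 2 first.
  - by move=> y l t' ls; rewrite /G' /f r0// Gs// inE ls orbT.
  - by move=> y l t' ls; rewrite /u' r0// us// inE ls orbT.
  over.
(* [m] is the value of coordinate [k] at which the form [r k] vanishes, the other coordinates being
   those of [x]. *)
set e := \sum_(i <- s) _; pose m := tnth x k - centered_form (r k) x.
under eq_integral => t _.
  rewrite /G' /u' Gs ?mem_head// us ?mem_head// /f centered_form_set_coord r1 mul1r.
  rewrite (_ : _ + (t - _) = t - m); last by rewrite /m; ring.
  rewrite -normal_pdf_shift// -mulrA.
  over.
by rewrite integral_normal_pdf_quad// big_cons -addrA.
Qed.

Lemma sqrtr_prod (I : Type) (s : seq I) (F : I -> R) : (forall i, 0 <= F i) ->
  Num.sqrt (\prod_(i <- s) F i) = \prod_(i <- s) Num.sqrt (F i).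
Proof.
move=> F0; elim: s => [|i s IH]; first by rewrite !big_nil sqrtr1.
by rewrite !big_cons sqrtrM// IH.
Qed.

Variable Sigma : 'M[R]_n.
Hypothesis Spd : posdefmx Sigma.

(* The density of [x_i] given [x_B], as the density of the residual. *)
Definition cond_normal B i x : R :=
  normal_pdf 0 (Num.sqrt (cond_var Sigma B i)) (centered_form (resid Sigma B i) x).

Lemma cond_sd_gt0 B i : i \notin B -> 0 < Num.sqrt (cond_var Sigma B i).
Proof. by move=> iB; rewrite sqrtr_gt0 cond_var_gt0. Qed.

Lemma cond_normalE B i x : i \notin B ->
  cond_normal B i x = (Num.sqrt (2 * pi * cond_var Sigma B i))^-1 *
    expR (- (centered_form (resid Sigma B i) x ^+ 2 / cond_var Sigma B i) / 2).
Proof.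
move=> iB; have cv0 := cond_var_gt0 Spd iB.
rewrite /cond_normal normal_pdfE ?gt_eqF ?cond_sd_gt0// /normal_peak /normal_fun.
rewrite sqr_sqrtr ?(ltW cv0)// subr0; congr (_^-1 * expR _).
  by congr Num.sqrt; rewrite -mulr_natl; ring.
by rewrite -mulr_natl; field; rewrite gt_eqF.
Qed.

(** A chain rule for any ordering: determinant and quadratic form both split along the successive
    residuals. *)
Lemma mvn_pdf_prod (rank : 'I_n -> nat) x : injective rank ->
  mvn_pdf mu Sigma x = \prod_i cond_normal (rank_pred rank i) i x.
Proof.
move=> rank_inj; rewrite /mvn_pdf (det_rank Spd rank_inj) (invmx_quad_rank Spd rank_inj).
under [RHS]eq_bigr => i _ do rewrite cond_normalE ?rank_predN//.
rewrite big_split/= -expR_sum prodfV; congr (_^-1 * expR _).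
  rewrite -sqrtr_prod => [|i]; last first.
    by rewrite mulr_ge0 ?mulr_ge0 ?pi_ge0// ltW// cond_var_gt0 ?rank_predN.
  by rewrite big_split/= prodr_const card_ord.
by rewrite -mulr_suml sumrN.
Qed.

Lemma pairwise_enum_lt (A : mem_pred 'I_n) :
  pairwise (fun k l : 'I_n => (k < l)%N) (enum_mem A).
Proof.
apply: (subseq_pairwise (filter_subseq A (Finite.enum 'I_n))).
rewrite -enumT -[pairwise _ _]/(pairwise (relpre val ltn) _) -pairwise_map.
by rewrite val_enum_ord -sorted_pairwise ?iota_ltn_sorted//; exact: ltn_trans.
Qed.

(** * Marginals on sets closed under conditioning *)

Section ClosedSet.
Variables (C : 'I_n -> {set 'I_n}) (B : {set 'I_n}).
Hypothesis C_B : forall j, j \in B -> C j = [set k in B | (k < j)%N].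

(* List the elements of [B] first: conditioning on all predecessors in that
   order amounts, inside [B], to conditioning on [C i]. *)
Let rank (i : 'I_n) : nat := if i \in B then val i else (n + i)%N.

Let rank_inj : injective rank.
Proof.
move=> i j; rewrite /rank; case: ifP => iB; case: ifP => jB.
- exact: val_inj.
- by move=> ij; have := ltn_ord i; rewrite ij -ltn_subRL subnn.
- by move=> ij; have := ltn_ord j; rewrite -ij -ltn_subRL subnn.
- by move=> /addnI/val_inj.
Qed.

Let rank_predB i : i \in B -> rank_pred rank i = C i.
Proof.
move=> iB; rewrite C_B//; apply/setP => k; rewrite !inE /rank iB.
case: ifP => kB //=; apply/negbTE; rewrite -leqNgt.
by rewrite (leq_trans (ltnW (ltn_ord i)))// leq_addr.
Qed.

(** With [B] ranked first, the factors in [B] involve only coordinates in [B]; the others are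
    triangular in the remaining coordinates and each integrates to 1. *)
Lemma marginal_pdf_closed x :
  marginal_pdf (mvn_pdf mu Sigma) B x = \prod_(i in B) cond_normal (C i) i x.
Proof.
pose P := rank_pred rank.
have PN i : i \notin P i by exact: rank_predN.
pose G y := \prod_(i in B) cond_normal (P i) i y.
pose s := enum (~: B).
(* The square is the constant 1 here: [u = 1] and all weights are 0. *)
have E : (fun y => (mvn_pdf mu Sigma y)%:E) = (fun y => (G y *
     ((fun=> 1) y + \sum_(i <- s) (fun=> 0) i * centered_form (resid Sigma (P i) i) y) ^+ 2 *
     \prod_(i <- s) normal_pdf 0 (Num.sqrt (cond_var Sigma (P i) i))
       (centered_form (resid Sigma (P i) i) y))%:E).
  apply/funext => y; rewrite (mvn_pdf_prod _ rank_inj) (bigID [in B])/=.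
  rewrite [\sum_(i <- s) _]big1 ?addr0 ?expr1n ?mulr1 => [|i _]; last by rewrite mul0r.
  by rewrite big_enum/=; congr (_ * _)%:E; apply: eq_bigl => i; rewrite inE.
rewrite /marginal_pdf E integrate_out_normal//.
- rewrite /= [\sum_(i <- s) _]big1 ?addr0 ?expr1n ?mulr1 => [|i _]; last first.
    by rewrite expr0n mul0r.
  by rewrite /G; apply: eq_bigr => i iB; rewrite /P rank_predB.
- by move=> k; exact: cond_sd_gt0.
- by move=> k; rewrite resid_notin// eqxx.
- have sB : all [in ~: B] s by apply/allP => k; rewrite mem_enum.
  apply: (sub_in_pairwise _ sB (pairwise_enum_lt _)) => k l.
  rewrite !inE => kB lB kl; rewrite resid_notin//; last first.
    by rewrite inE /rank (negbTE kB) (negbTE lB) ltn_add2l ltnNge ltnW.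
  by rewrite -val_eqE/= gtn_eqF.
- move=> y k t; rewrite mem_enum inE => kB; apply: eq_bigr => i iB.
  rewrite /cond_normal centered_form_set_coord resid_notin// ?rank_predB//.
    by case: eqVneq => [ki|_]; [rewrite ki iB in kB|rewrite mul0r addr0].
  by rewrite /P rank_predB// C_B// inE (negbTE kB).
Qed.

End ClosedSet.

End IteratedNormal.

(** * Hierarchical partitions *)

Section HierarchicalPartition.
Context {n : nat} (J : seq nat) (X : seq nat -> {set 'I_n}).
Hypothesis HX : hierarchical_partition J X.

Let C := conditioning_set J X.

(** The first [p] sets on the path from the root to [s]: [p = size s] gives the ancestors, one more
    adds [X s]. One closure lemma then serves numerators and denominators. *)
Definition branch (s : seq nat) (p : nat) : {set 'I_n} := \bigcup_(m < p) X (take m s).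

Lemma branchP s p (k : 'I_n) :
  reflect (exists2 m, (m < p)%N & k \in X (take m s)) (k \in branch s p).
Proof.
apply: (iffP bigcupP) => [[m _ km]|[m mp km]]; first by exists m.
by exists (Ordinal mp).
Qed.

Lemma branchS s : branch s (size s).+1 = ancestors X s :|: X s.
Proof. by rewrite /branch big_ord_recr/= take_size. Qed.

Lemma take_nodes s m : s \in nodes J -> take m s \in nodes J.
Proof.
rewrite !mem_nodes => /andP[sJ sa]; apply/andP; split.
  by rewrite size_take; case: ifP => // /ltnW /leq_trans; exact.
by elim: s m (J) sa {sJ} => [|a s IH] [|m] [|b J']//= /andP[-> /IH->].
Qed.

Lemma node_unique s t k :
  s \in nodes J -> t \in nodes J -> k \in X s -> k \in X t -> s = t.
Proof.
case: HX => _ dX _ _ sJ tJ ks kt; apply/eqP; apply: contraT => st.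
by have /disjoint_setI0/setP/(_ k) := dX s t sJ tJ st; rewrite !inE ks kt.
Qed.

Lemma bigcup_seqP (I : eqType) (r : seq I) (P : pred I) (F : I -> {set 'I_n}) k :
  reflect (exists2 i, (i \in r) && P i & k \in F i) (k \in \bigcup_(i <- r | P i) F i).
Proof.
elim: r => [|i r IH]; first by rewrite big_nil inE; constructor => -[].
rewrite big_cons; apply: (iffP idP) => [|[j]].
  case: ifP => Pi; last by case/IH => j /andP[jr Pj] kj; exists j; rewrite // inE jr orbT.
  rewrite inE => /orP[ki|/IH[j /andP[jr Pj] kj]]; first by exists i; rewrite ?mem_head.
  by exists j; rewrite // inE jr orbT.
rewrite inE => /andP[/predU1P[->|jr] Pj] kj; first by rewrite Pj inE kj.
have : k \in \bigcup_(i <- r | P i) F i by apply/IH; exists j; rewrite ?jr.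
by case: ifP => // _ H; rewrite inE H orbT.
Qed.

(** Disjointness excludes [k = l], and compatibility of the ordering with the levels excludes
    [l < k]. *)
Lemma node_size_lt s t (k l : 'I_n) : s \in nodes J -> t \in nodes J ->
  k \in X s -> l \in X t -> (size s < size t)%N -> (k < l)%N.
Proof.
move=> sJ tJ ks lt st; rewrite ltnNge leq_eqVlt negb_or; apply/andP; split.
  apply: contraTN st => /eqP/val_inj lk; rewrite -lk in ks.
  by rewrite (node_unique sJ tJ ks lt) ltnn.
apply: contraTN st => lk; rewrite -leqNgt; case: HX => _ _ _ /(_ k l _ _ lk); apply.
  by apply/bigcup_seqP; exists s => //; rewrite sJ/=.
by apply/bigcup_seqP; exists t => //; rewrite tJ/=.
Qed.

Lemma conditioning_set_node s i : s \in nodes J -> i \in X s ->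
  C i = ancestors X s :|: [set k in X s | (k < i)%N].
Proof.
move=> sJ si; apply/setP => k; apply/bigcup_seqP/idP => [[t /andP[tJ ti]]|H].
  by rewrite (node_unique sJ tJ si ti).
by exists s; rewrite // sJ.
Qed.

(** If [j] lies at depth [m], the shallower sets of the branch precede it and the deeper ones follow
    it. Its predecessors in the branch are thus its ancestors and the earlier elements of its own
    set. *)
Lemma branch_closed s p j : s \in nodes J -> (p <= (size s).+1)%N ->
  j \in branch s p -> C j = [set k in branch s p | (k < j)%N].
Proof.
move=> sJ ps /branchP[m mp jm].
have szt q : (q < p)%N -> size (take q s) = q.
  by move=> qp; rewrite size_takel// -ltnS (leq_trans qp).
rewrite (conditioning_set_node (take_nodes m sJ) jm).
have -> : ancestors X (take m s) = branch s m.
  rewrite /ancestors szt//; apply: eq_bigr => q _.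
  by rewrite take_takel// ltnW.
apply/setP => k; rewrite !inE; apply/orP/andP.
  case=> [/branchP[q qm kq]|/andP[km kj]].
    have qp := ltn_trans qm mp.
    split; first by apply/branchP; exists q.
    by apply: node_size_lt kq jm _; rewrite ?take_nodes ?szt.
  by split=> //; apply/branchP; exists m.
move=> [/branchP[q qp kq] kj]; case: (ltngtP q m) => qm.
- by left; apply/branchP; exists q.
- have : (j < k)%N by apply: node_size_lt jm kq _; rewrite ?take_nodes ?szt.
  by rewrite ltnNge ltnW.
- by right; rewrite -qm kq.
Qed.

Lemma exists_node i : exists2 s, s \in nodes J & i \in X s.
Proof.
case: HX => _ _ /setP/(_ i) + _; rewrite inE => /bigcup_seqP[s].
by rewrite andbT => sJ si; exists s.
Qed.

Lemma conditioning_set_branch s i : s \in nodes J -> i \in X s ->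
  C i = [set k in branch s (size s).+1 | (k < i)%N].
Proof.
by move=> sJ si; apply: branch_closed => //; rewrite branchS inE si orbT.
Qed.

Lemma conditioning_set_lt i j : j \in C i -> (j < i)%N.
Proof.
have [s sJ si] := exists_node i.
by rewrite (conditioning_set_branch sJ si) inE => /andP[].
Qed.

(** Both sets are initial segments of the same branch. *)
Lemma conditioning_set_nested i j :
  j \in C i -> C j = [set k in C i | (k < j)%N].
Proof.
have [s sJ si] := exists_node i.
rewrite (conditioning_set_branch sJ si) inE => /andP[js ji].
rewrite (branch_closed sJ _ js)//; apply/setP => k; rewrite !inE -andbA.
by case: (k < j)%N / boolP => [kj|]; rewrite ?andbF// (ltn_trans kj ji).
Qed.

Lemma ancestors_disjoint s : s \in nodes J -> [disjoint X s & ancestors X s].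
Proof.
move=> sJ; apply/pred0P => k /=; apply/negbTE/negP => /andP[ks /branchP[m ms km]].
have := node_size_lt (take_nodes m sJ) sJ km ks.
by rewrite size_takel ?ltnn ?(ltnW ms)// => /(_ ms).
Qed.

Lemma nodes_prod (R : comPzSemiRingType) (F : 'I_n -> R) :
  \prod_(s <- nodes J) \prod_(i in X s) F i = \prod_i F i.
Proof.
under eq_bigr do rewrite big_mkcond.
rewrite exchange_big/=; apply: eq_bigr => i _.
have [s sJ si] := exists_node i.
rewrite (bigD1_seq s)//= ?nodes_uniq// si big_seq_cond big1 ?mulr1// => t.
move=> /andP[tJ ts]; case: ifP => // ti.
by rewrite (node_unique tJ sJ ti si) eqxx in ts.
Qed.

(** Each quotient is one of marginals on closed sets: the positive ancestor factors cancel, and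
    those of [X s] remain. *)
Lemma hv_pdf_prod (R : realType) (mu : 'cV[R]_n) (Sigma : 'M[R]_n) x :
  posdefmx Sigma ->
  hv_pdf J X mu Sigma x = \prod_i cond_normal mu Sigma (C i) i x.
Proof.
move=> Spd; rewrite -nodes_prod; apply: eq_big_seq => s sJ.
have NC i : i \notin C i by apply/negP => /conditioning_set_lt; rewrite ltnn.
rewrite /cond_pdf !(@marginal_pdf_closed _ _ _ _ Spd C)//; last 2 first.
- move=> j; exact: (@branch_closed s (size s)).
- by move=> j; rewrite finset.setUC -branchS; exact: branch_closed.
rewrite (eq_bigl [predU X s & ancestors X s]) => [|i]; last by rewrite !inE.
rewrite bigU ?ancestors_disjoint//= mulfK//; apply/prodf_neq0 => i _.
by rewrite gt_eqF// normal_pdf_gt0// cond_sd_gt0.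
Qed.

End HierarchicalPartition.

(** * Expectations from densities *)

Section IterateIntegral.
Local Open Scope classical_set_scope.
Context {R : realType} {n : nat}.
Notation T := (n.-tuple R).

Lemma measurable_set_coord d (T0 : measurableType d) (f : T0 -> T) (g : T0 -> R) k :
  measurable_fun setT f -> measurable_fun setT g ->
  measurable_fun setT (fun z => set_coord (f z) k (g z)).
Proof.
move=> mf mg; apply/measurable_fun_tnthP => i.
have [->|ik] := eqVneq i k.
  by apply: eq_measurable_fun mg => z _; rewrite /= tnth_mktuple eqxx.
apply: (@eq_measurable_fun _ _ _ _ _ ((fun y : T => tnth y i) \o f)).
  by move=> z _; rewrite /= tnth_mktuple (negbTE ik).
by apply: measurableT_comp mf; exact: measurable_tnth.
Qed.

Lemma integrate_out_ge0 (s : seq 'I_n) (f : T -> \bar R) x :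
  (forall y, 0 <= f y)%E -> (0 <= integrate_out s f x)%E.
Proof.
by move=> f0; elim: s x => [|k s IH] x //=; apply: integral_ge0 => t _; exact: IH.
Qed.

(** The parameter [z.1] is carried along because Tonelli's theorem asks for joint measurability. *)
Lemma measurable_integrate_out d (T0 : measurableType d) (s : seq 'I_n)
    (F : T0 * T -> \bar R) :
  measurable_fun setT F -> (forall z, 0 <= F z)%E ->
  measurable_fun setT
    (fun z : T0 * T => integrate_out s (fun y => F (z.1, y)) z.2).
Proof.
move=> mF F0; elim: s => [|k s IH] /=.
  by apply: eq_measurable_fun mF => -[].
pose H (u : (T0 * T) * R) :=
  integrate_out s (fun y => F (u.1.1, y)) (set_coord u.1.2 k u.2).
apply: (@measurable_fun_fubini_tonelli_F _ _ _ _ _ lebesgue_measure H).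
  apply: (@measurableT_comp _ _ _ _ _ _
    (fun z : T0 * T => integrate_out s (fun y => F (z.1, y)) z.2) _
    (fun u : (T0 * T) * R => (u.1.1, set_coord u.1.2 k u.2))) => //.
  apply: measurable_fun_pair => /=; first exact: measurableT_comp.
  by apply: measurable_set_coord => //; exact: measurableT_comp.
by move=> u; exact: integrate_out_ge0.
Qed.

Lemma integral_integrate_out d (T0 : measurableType d)
    (m : {sigma_finite_measure set T0 -> \bar R}) (s : seq 'I_n)
    (F : T0 * T -> \bar R) x :
  measurable_fun setT F -> (forall z, 0 <= F z)%E ->
  (\int[m]_r integrate_out s (fun y => F (r, y)) x =
   integrate_out s (fun y => \int[m]_r F (r, y)) x)%E.
Proof.
move=> mF F0; elim: s x => [//|k s IH] x /=.
rewrite (fubini_tonelli (m1 := m) (m2 := lebesgue_measure) (fun u : T0 * R =>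
  integrate_out s (fun y => F (u.1, y)) (set_coord x k u.2)))/=.
- by apply: eq_integral => t _; rewrite IH.
- apply: (@measurableT_comp _ _ _ _ _ _
    (fun z : T0 * T => integrate_out s (fun y => F (z.1, y)) z.2) _
    (fun u : T0 * R => (u.1, set_coord x k u.2))) => //.
    exact: measurable_integrate_out.
  apply: measurable_fun_pair => //=.
  by apply: measurable_set_coord => //; exact: measurable_cst.
- by move=> u; exact: integrate_out_ge0.
Qed.

(* Layer-cake formula: the tail probabilities of [h] are given by the density,
   and Tonelli's theorem exchanges them with the iterated integral. *)
Lemma has_pdf_integral d (Omega : measurableType d) (P : probability Omega R)
    (X : 'I_n -> {RV P >-> R}) (p h : T -> R) :
  measurable_fun setT p -> (forall y, 0 <= p y) ->
  measurable_fun setT h -> (forall y, 0 <= h y) ->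
  has_pdf X p ->
  (\int[P]_w (h [tuple X i w | i < n])%:E = integral_Rn (fun y => (h y * p y)%:E))%E.
Proof.
move=> mp p0 mh h0 Xp.
have mX : measurable_fun setT (fun w => [tuple X i w | i < n]).
  apply/measurable_fun_tnthP => i.
  apply: (@eq_measurable_fun _ _ _ _ _ (X i)) => [w _|]; first by rewrite /= tnth_mktuple.
  exact: measurable_funPT.
have mY : measurable_fun setT (fun w => h [tuple X i w | i < n]).
  exact: measurableT_comp mh mX.
pose Y : {RV P >-> R} := mfun_Sub (mem_set mY).
have -> : (\int[P]_w (h [tuple X i w | i < n])%:E = 'E_P[Y])%E by rewrite unlock.
rewrite ge0_expectation_ccdf; last by move=> w; exact: h0.
(* The region [0 <= r < h y] under the graph of [h]. *)
pose A := [set z : R * T | 0 <= z.1] `&` [set z : R * T | 0 < h z.2 - z.1].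
have mA : measurable A.
  apply: measurableI.
    rewrite -[X in measurable X]setTI.
    rewrite (_ : [set z : R * T | 0 <= z.1] = fst @^-1` `[0, +oo[); last first.
      by apply/seteqP; split=> z /=; rewrite in_itv/= andbT.
    exact: measurable_fst.
  rewrite -[X in measurable X]setTI.
  rewrite (_ : [set z : R * T | 0 < h z.2 - z.1] =
      (fun z => h z.2 - z.1) @^-1` `]0, +oo[); last first.
    by apply/seteqP; split=> z /=; rewrite in_itv/= andbT.
  have : measurable_fun setT (fun z : R * T => h z.2 - z.1).
    by apply: measurable_funB => //; exact: measurableT_comp.
  by apply.
pose F (z : R * T) := (\1_A z * p z.2)%:E.
have mF : measurable_fun setT F.
  apply/measurable_EFinP; apply: measurable_funM; first exact: measurable_indic.
  exact: measurableT_comp.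
have F0 z : (0 <= F z)%E by rewrite lee_fin mulr_ge0.
transitivity (\int[lebesgue_measure]_r integral_Rn (fun y => F (r, y)))%E.
  rewrite integral_mkcond; apply: eq_integral => r _.
  rewrite patchE; case: ifPn => [|rD].
    rewrite inE/= in_itv/= andbT => r0; rewrite /ccdf/=.
    rewrite -[LHS]/(P [set w | (h @^-1` `]r, +oo[) [tuple X i w | i < n]]).
    rewrite Xp; last by rewrite -[X in measurable X]setTI; exact: mh.
    congr integral_Rn; apply/funext => y; rewrite /F /=; congr (_ * _)%:E.
    rewrite !indicE; congr ((nat_of_bool _)%:R); apply/idP/idP; rewrite !inE /A /=.
      by rewrite in_itv/= andbT subr_gt0.
    by rewrite in_itv/= andbT subr_gt0 => -[].
  rewrite (_ : (fun y => F (r, y)) = cst 0%E); last first.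
    apply/funext => y; rewrite /F indicE memNset ?mul0r// => -[/= r0 _].
    by move: rD; rewrite notin_setE/= in_itv/= r0.
  by rewrite /integral_Rn; elim: (enum _) [tuple _ | _ < _] => [//|k s IH] y /=;
     under eq_integral do rewrite -IH; rewrite integral0.
transitivity (integral_Rn (fun y => \int[lebesgue_measure]_r F (r, y)))%E.
  exact: (@integral_integrate_out _ _ lebesgue_measure _ _ _ mF F0).
congr integral_Rn; apply/funext => y.
(* The slice of [A] over [y] is [[0, h y[], of length [h y]. *)
transitivity (\int[lebesgue_measure]_r ((p y)%:E * (\1_(`[0, h y[) r)%:E))%E.
  apply: eq_integral => r _; rewrite /F mulrC EFinM; congr (_ * ((nat_of_bool _)%:R)%:E)%E.
  apply/idP/idP; rewrite !inE /A/= in_itv/= subr_gt0; first by case=> -> ->.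
  by case/andP.
rewrite ge0_integralZl_EFin//; last first.
- by apply/measurable_EFinP; exact: measurable_indic.
rewrite integral_indic// setIT.
transitivity ((p y)%:E * lebesgue_measure (`[0%R, h y[ : set R))%E => //.
rewrite lebesgue_measure_itv/= lte_fin.
have := h0 y; rewrite le_eqVlt => /orP[/eqP <-|->]; last by rewrite oppr0 adde0 -EFinM mulrC.
by rewrite ltxx mule0 mul0r.
Qed.

End IterateIntegral.

(** * Covariance of the approximation *)

Section Polarization.
Local Open Scope classical_set_scope.
Context {R : realType} d (Omega : measurableType d) (P : probability Omega R).
Variables (U V : Omega -> R) (a b k : R).
Hypotheses (mU : measurable_fun setT U) (mV : measurable_fun setT V).
Hypothesis U2 : (\int[P]_w (U w ^+ 2)%:E = a%:E)%E.
Hypothesis V2 : (\int[P]_w (V w ^+ 2)%:E = b%:E)%E.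
Hypothesis UV2 : (\int[P]_w ((U w + V w) ^+ 2)%:E = (a + b + 2 * k)%:E)%E.

(** Integrability comes from [|U * V| <= U ^+ 2 + V ^+ 2], the value from expanding the square of
    [U + V]. The data are integrals of squares because the layer-cake formula handles nonnegative
    functions. *)
Lemma polarization :
  P.-integrable setT (fun w => (U w * V w)%:E) /\
  (\int[P]_w (U w * V w)%:E = k%:E)%E.
Proof.
have sq (f : Omega -> R) (e : R) : measurable_fun setT f ->
    (\int[P]_w (f w ^+ 2)%:E = e%:E)%E ->
    P.-integrable setT (fun w => (f w ^+ 2)%:E).
  move=> mf fe; apply/integrableP; split.
    by apply/measurable_EFinP; exact: measurable_funX.
  under eq_integral => w _ do rewrite gee0_abs ?lee_fin ?sqr_ge0//.
  by rewrite fe ltry.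
have iU := sq _ _ mU U2; have iV := sq _ _ mV V2.
have iUV2 := integrableD measurableT iU iV.
have iUV : P.-integrable setT (fun w => (U w * V w)%:E).
  apply: le_integrable iUV2 => //.
    by apply/measurable_EFinP; exact: measurable_funM.
  move=> w _ /=; rewrite lee_fin [leRHS]ger0_norm ?addr_ge0 ?sqr_ge0//.
  rewrite normrM -[U w ^+ 2]real_normK ?num_real// -[V w ^+ 2]real_normK ?num_real//.
  have := sqr_ge0 (`|U w| - `|V w|).
  by have := normr_ge0 (U w); have := normr_ge0 (V w); nra.
split=> //; have := integrable_fin_num measurableT iUV.
have i2 := integrableZl measurableT 2 iUV.
have : (\int[P]_w ((U w + V w) ^+ 2)%:E =
    \int[P]_w (U w ^+ 2)%:E + \int[P]_w (V w ^+ 2)%:E + 2%:E * \int[P]_w (U w * V w)%:E)%E.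
  rewrite -integralD// -integralZl// -integralD//.
  by apply: eq_integral => w _; rewrite -!EFinM -!EFinD; congr EFin; ring.
rewrite UV2 U2 V2; case: (integral _ _ _) => [r|//|//] + _.
by rewrite -EFinM -!EFinD => -[H]; congr EFin; lra.
Qed.

End Polarization.

(** * Mean and covariance under the approximation *)

Section HVMoments.
Local Open Scope classical_set_scope.
Context {R : realType} {n : nat} (J : seq nat) (X : seq nat -> {set 'I_n}).
Variables (mu : 'cV[R]_n) (Sigma : 'M[R]_n).
Context d (Omega : measurableType d) (P : probability Omega R).
Variable x : 'I_n -> {RV P >-> R}.
Hypotheses (HX : hierarchical_partition J X) (Spd : posdefmx Sigma).
Hypothesis xp : has_pdf x (hv_pdf J X mu Sigma).

Let C := conditioning_set J X.
Let C_lt := conditioning_set_lt HX.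
Let C_nested := conditioning_set_nested HX.
Let L := hv_chol Sigma C.

Let NC i : i \notin C i.
Proof. by apply/negP => /C_lt; rewrite ltnn. Qed.

Lemma measurable_centered_form (r : 'rV[R]_n) :
  measurable_fun setT (centered_form mu r).
Proof.
rewrite (_ : centered_form mu r =
    fun y => \sum_(k < n) r 0 k * (tnth y k - mu k 0)); last first.
  by apply/funext => y; rewrite /centered_form mxE; apply: eq_bigr => k _; rewrite !mxE.
apply: measurable_sum => k; apply: measurable_funM => //.
by apply: measurable_funB => //; exact: measurable_tnth.
Qed.

Lemma measurable_cond_normal B i : measurable_fun setT (cond_normal mu Sigma B i).
Proof.
by apply: measurableT_comp (measurable_centered_form _); exact: measurable_normal_pdf.
Qed.

Let pE : hv_pdf J X mu Sigma = fun y => \prod_i cond_normal mu Sigma (C i) i y.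
Proof. by apply/funext => y; rewrite (hv_pdf_prod HX). Qed.

(** The residuals act as independent centered normals: [C i] precedes [i], so the increasing
    enumeration makes the forms triangular. *)
Lemma integral_resid_form (w : 'I_n -> R) c :
  (\int[P]_o ((c + \sum_i w i *
      centered_form mu (resid Sigma (C i) i) [tuple x i o | i < n]) ^+ 2)%:E =
   (c ^+ 2 + \sum_i w i ^+ 2 * cond_var Sigma (C i) i)%:E)%E.
Proof.
pose h (y : n.-tuple R) :=
  (c + \sum_i w i * centered_form mu (resid Sigma (C i) i) y) ^+ 2.
have -> := @has_pdf_integral _ _ _ _ P x (hv_pdf J X mu Sigma) h _ _ _ _ xp; last first.
- by move=> y; exact: sqr_ge0.
- apply: measurable_funX; apply: measurable_funD => //.
  apply: measurable_sum => k; apply: measurable_funM => //.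
  exact: measurable_centered_form.
- by move=> y; rewrite pE prodr_ge0// => i _; exact: normal_pdf_ge0.
- by rewrite pE; apply: measurable_prod => i _; exact: measurable_cond_normal.
pose s := enum 'I_n.
have -> : (fun y => (h y * hv_pdf J X mu Sigma y)%:E) = (fun y => ((fun=> 1) y *
     ((fun=> c) y + \sum_(i <- s) w i * centered_form mu (resid Sigma (C i) i) y) ^+ 2 *
     \prod_(i <- s) normal_pdf 0 (Num.sqrt (cond_var Sigma (C i) i))
       (centered_form mu (resid Sigma (C i) i) y))%:E).
  by apply/funext => y; rewrite pE /h !big_enum/= mul1r.
rewrite /integral_Rn integrate_out_normal//.
- rewrite mul1r big_enum/=; congr (_ + _)%:E; apply: eq_bigr => i _.
  by rewrite sqr_sqrtr// ltW// cond_var_gt0.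
- by move=> k; exact: cond_sd_gt0.
- by move=> k; rewrite resid_notin// eqxx.
- apply: sub_pairwise (pairwise_enum_lt _) => k l kl; rewrite resid_notin//.
    by rewrite -val_eqE/= gtn_eqF.
  by apply/negP => /C_lt; rewrite ltnNge ltnW.
Qed.

(** In terms of the residuals, the form [v] has coefficients [v *m W^-1] with
    [W = resid_mx Sigma C]. The constant [c] gives access to the mean. *)
Lemma integral_centered_form (v : 'rV[R]_n) c :
  (\int[P]_o ((c + centered_form mu v [tuple x i o | i < n]) ^+ 2)%:E =
   (c ^+ 2 + (v *m (L *m L^T) *m v^T) 0 0)%:E)%E.
Proof.
pose w i := (v *m invmx (resid_mx Sigma C)) 0 i.
have E y : centered_form mu v y =
    \sum_i w i * centered_form mu (resid Sigma (C i) i) y.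
  rewrite /centered_form -{1}[v](mulmxKV (resid_mx_unit Spd C_lt)).
  rewrite -[_ *m (_ - mu)]mulmxA mxE.
  by apply: eq_bigr => i _; rewrite resid_mxM.
under eq_integral => o _ do rewrite E.
rewrite integral_resid_form; congr (_ + _)%:E.
rewrite mulmxA -mulmxA -trmx_mul mxE; apply: eq_bigr => i _.
rewrite trmxE -expr2 /L /hv_chol mulmxA mul_mx_diag mxE exprMn.
by rewrite [fun_of_matrix (\row_j Num.sqrt _) 0 i]mxE sqr_sqrtr// ltW// cond_var_gt0.
Qed.

Lemma covmx_hv : covmx x = L *m L^T.
Proof.
set K := L *m L^T.
pose Z i o := x i o - mu i 0.
pose e i : 'rV[R]_n := delta_mx 0 i.
have ZE i o : Z i o = centered_form mu (e i) [tuple x i o | i < n].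
  by rewrite /centered_form -rowE !mxE tnth_mktuple.
have KE i j : (e i *m K *m (e j)^T) 0 0 = K i j.
  by rewrite -rowE trmx_delta -colE !mxE.
have Ksym i j : K j i = K i j by rewrite -[LHS]trmxE trmx_mul trmxK.
have mZ i : measurable_fun setT (Z i).
  by apply: measurable_funB => //; exact: measurable_funPT.
have ZZ i : (\int[P]_o (Z i o ^+ 2)%:E = (K i i)%:E)%E.
  have := integral_centered_form (e i) 0; rewrite expr0n add0r -/K KE => <-.
  by apply: eq_integral => o _; rewrite add0r ZE.
(* Polarizing against the constant 1 extracts the first moment. *)
have Z1 i : P.-integrable setT (fun o => (Z i o)%:E) /\ (\int[P]_o (Z i o)%:E = 0)%E.
  have e1 : (\int[P]_o (cst (1 : R) o ^+ 2)%:E = 1%:E)%E.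
    under eq_integral do rewrite expr1n.
    by rewrite integral_cst//= probability_setT mule1.
  have eZ1 : (\int[P]_o ((Z i o + cst 1 o) ^+ 2)%:E = (K i i + 1 + 2 * 0)%:E)%E.
    rewrite mulr0 addr0 addrC; have := integral_centered_form (e i) 1.
    rewrite expr1n -/K KE => <-.
    by apply: eq_integral => o _; rewrite /= addrC ZE.
  have [iZ eZ] := polarization (mZ i) (measurable_cst _) (ZZ i) e1 eZ1.
  have E : (fun o => (Z i o * cst 1 o)%:E) = (fun o => (Z i o)%:E).
    by apply/funext => o; rewrite /= mulr1.
  by move: iZ eZ; rewrite E => iZ eZ; split.
(* The covariance is centered at the expectations, which are identified with [mu] first. *)
have Ex i : ('E_P[x i] = (mu i 0)%:E)%E.
  have [iZ eZ] := Z1 i; rewrite unlock.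
  transitivity (\int[P]_o ((Z i o)%:E + (mu i 0)%:E))%E.
    by apply: eq_integral => o _; rewrite -EFinD subrK.
  rewrite integralD//; last exact: finite_measure_integrable_cst.
  by rewrite eZ add0e integral_cst//= probability_setT mule1.
apply/matrixP => i j; rewrite mxE covariance.unlock !Ex/= expectation.unlock.
have DE (A B : 'M[R]_1) : (A + B) 0 0 = A 0 0 + B 0 0 by rewrite mxE.
have eZZ : (\int[P]_o ((Z i o + Z j o) ^+ 2)%:E = (K i i + K j j + 2 * K i j)%:E)%E.
  have := integral_centered_form (e i + e j) 0; rewrite expr0n add0r -/K.
  have -> : ((e i + e j) *m K *m (e i + e j)^T) 0 0 = K i i + K j j + 2 * K i j.
    by rewrite linearD/= !mulmxDl !mulmxDr !DE !KE (Ksym i j); ring.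
  move=> <-; apply: eq_integral => o _; rewrite add0r !ZE.
  by rewrite /centered_form mulmxDl DE.
have [_ eZ] := polarization (mZ i) (mZ j) (ZZ i) (ZZ j) eZZ.
by rewrite [X in fine X](_ : _ = (K i j)%:E).
Qed.

End HVMoments.

(** * Agreement of the two factorizations *)

Theorem proposition3 (R : realType) (n M : nat) (J : M.-tuple nat)
    (X : seq nat -> {set 'I_n}) (mu : 'cV[R]_n) (Sigma : 'M[R]_n)
    (d : measure_display) (Omega : measurableType d) (P : probability Omega R)
    (x : 'I_n -> {RV P >-> R}) :
  hierarchical_partition J X ->
  posdefmx Sigma ->
  has_pdf x (hv_pdf J X mu Sigma) ->
  posdefmx (covmx x) /\ chol (covmx x) = ichol Sigma (sparsity J X).
Proof.
move=> HX Spd xp.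
have C_lt := conditioning_set_lt HX.
have C_nested := conditioning_set_nested HX.
set C := conditioning_set J X in C_lt C_nested.
(* One matrix plays both roles: Cholesky factor of the covariance and solution of the incomplete
   recursion. *)
have Lchol : is_chol (covmx x) (hv_chol Sigma C).
  split; [exact: hv_chol_trig|exact: hv_chol_gt0|].
  by rewrite (covmx_hv HX Spd xp).
split; first exact: is_chol_posdefmx Lchol.
rewrite (cholE Lchol); apply/esym/ichol_eq.
- exact: hv_chol_trig.
- exact: hv_chol_gt0.
- move=> i j ji; rewrite mxE negb_or => /andP[jC ij].
  by rewrite hv_cholE (inv_resid_mx_eq0 Spd)// mul0r.
- by move=> i j _; rewrite mxE => ij; exact: hv_cholM_eq.
- by move=> i; apply: hv_cholM_eq => //; rewrite eqxx orbT.
Qed.
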